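(* Let $g\ge3$ and $2\le k<g$ be integers, and let $N=\sum_{i=0}^{n-1}a_ig^i$ (digits $0\le a_i<g$, $a_{n-1}\ne0$) be a $(g,k)$-reverse multiple. Then $a_0+a_{n-1}\le g$. Moreover, if $a_0+a_{n-1}=g$, then $k+1$ divides $g$.
   Context: A positive integer $N=\sum_{i=0}^{n-1}a_ig^i$ with base-$g$ digits $0\le a_i<g$ and $a_{n-1}\ne 0$ is a $(g,k)$-reverse multiple if $kN=\sum_{i=0}^{n-1}a_{n-1-i}g^i$, i.e. $k$ times $N$ equals the number whose base-$g$ digit string is that of $N$ reversed. *)

(* Defs.v *)
From mathcomp Require Import all_boot.
Set Implicit Arguments.
Unset Strict Implicit.
Unset Printing Implicit Defensive.

(* Only the values [a i] with [i < n] are digits. The guard [0 < n] makes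
   [n.-1] the true index of the leading digit. *)
Definition base_digits (g n : nat) (a : nat -> nat) (N : nat) : Prop :=
  [/\ 0 < n,
      forall i, i < n -> a i < g,
      a n.-1 <> 0 &
      N = \sum_(i < n) a i * g ^ i].

Definition reverse_multiple (g k N : nat) : Prop :=
  exists (n : nat) (a : nat -> nat),
    base_digits g n a N /\ k * N = \sum_(i < n) a (n.-1 - i) * g ^ i.

(* Main.v *)
Require Import Defs.
From mathcomp Require Import all_boot.
From mathcomp Require Import zify.

Set Implicit Arguments.
Unset Strict Implicit.
Unset Printing Implicit Defensive.

(** Let [b] be the last and [t] the leading digit of [N]. Comparing last digits
of [k * N] and the reversal gives [k * b = t + r * g] with [r < k]; comparing
leading digits gives [k * t <= b]. Writing [b = k * t + c], this yields
[(k - 1) * (b + t) = r * g - c <= (k - 1) * g - c], hence [b + t <= g]; equality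
forces [c = 0], so that [g = b + t = (k + 1) * t]. *)

Local Notation expansion g n a := (\sum_(i < n) a i * g ^ i).

Lemma expansion_ltn_exp g n (a : nat -> nat) :
  (forall i, i < n -> a i < g) -> expansion g n a < g ^ n.
Proof.
elim: n => [_|n IHn a_lt]; first by rewrite big_ord0.
have tail_lt : expansion g n a < g ^ n.
  by apply: IHn => i lt_in; apply/a_lt/ltnW.
rewrite big_ord_recr /=; apply: (@leq_trans ((a n).+1 * g ^ n)).
  by rewrite mulSn ltn_add2r.
by rewrite expnS leq_mul2r a_lt ?orbT.
Qed.

Lemma expansion_addn g m n (a : nat -> nat) :
  expansion g (m + n) a
    = expansion g n (fun i => a (m + i)) * g ^ m + expansion g m a.
Proof.
rewrite big_split_ord /= [RHS]addnC big_distrl; congr (_ + _).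
by apply: eq_bigr => i _; rewrite /= expnD mulnCA mulnC.
Qed.

Lemma expansion_divn g m n (a : nat -> nat) :
  (forall i, i < m + n -> a i < g) ->
  expansion g (m + n) a %/ g ^ m = expansion g n (fun i => a (m + i)).
Proof.
move=> a_lt; have low_lt : expansion g m a < g ^ m.
  by apply: expansion_ltn_exp => i lt_im; rewrite a_lt // ltn_addr.
have gm_gt0 : 0 < g ^ m by apply: leq_ltn_trans low_lt.
by rewrite expansion_addn divnMDl // divn_small // addn0.
Qed.

Lemma expansion_modn g n (a : nat -> nat) :
  0 < n -> expansion g n a = a 0 %[mod g].
Proof.
case: n => // n _.
by rewrite -add1n expansion_addn expn1 modnMDl big_ord1 muln1.
Qed.

Lemma expansion_digit g n (a : nat -> nat) i :
  (forall j, j < n -> a j < g) -> i < n ->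
  (expansion g n a %/ g ^ i) %% g = a i.
Proof.
move=> a_lt lt_in; have def_n := subnKC (ltnW lt_in).
rewrite -def_n expansion_divn ?def_n //.
rewrite (expansion_modn g (fun j => a (i + j))) ?subn_gt0 //.
by rewrite addn0 modn_small ?a_lt.
Qed.

Lemma expansion_lead g n (a : nat -> nat) :
  0 < n -> (forall i, i < n -> a i < g) ->
  expansion g n a %/ g ^ n.-1 = a n.-1.
Proof.
case: n => // n _ a_lt; have := @expansion_divn g n 1 a; rewrite addn1 => -> //.
by rewrite big_ord1 addn0 muln1.
Qed.

Lemma base_digits_size g n a N : base_digits g n a N -> n = (trunc_log g N).+1.
Proof.
move=> [n_gt0 a_lt lead_neq0 def_N].
have lead_gt0 : 0 < a n.-1 by lia.
have lead_lt : a n.-1 < g by apply: a_lt; rewrite prednK.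
have g_gt1 : 1 < g by lia.
rewrite -(prednK n_gt0); congr _.+1; apply/esym/trunc_log_eq => //.
rewrite prednK // {2}def_N expansion_ltn_exp // andbT.
by rewrite -divn_gt0 ?expn_gt0 ?(ltnW g_gt1) // def_N expansion_lead.
Qed.

Lemma base_digits_inj g m n a b N :
  base_digits g m a N -> base_digits g n b N ->
  m = n /\ (forall i, i < m -> a i = b i).
Proof.
move=> a_digits b_digits.
have eq_mn : m = n.
  by rewrite (base_digits_size a_digits) (base_digits_size b_digits).
split=> // i lt_im.
have [_ a_lt _ def_N] := a_digits; have [_ b_lt _ def_N'] := b_digits.
rewrite -(expansion_digit a_lt lt_im) -def_N def_N' expansion_digit //.
by rewrite -eq_mn.
Qed.

Section ReverseMultiple.

Variables (g k N n : nat) (a : nat -> nat).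
Hypotheses (N_digits : base_digits g n a N) (N_rev : reverse_multiple g k N).

Lemma reverse_multiple_expansion :
  k * N = expansion g n (fun i => a (n.-1 - i)).
Proof.
have [m [b [b_digits ->]]] := N_rev.
have [<- eq_ab] := base_digits_inj N_digits b_digits.
have [n_gt0 _ _ _] := N_digits.
by apply: eq_bigr => i _; rewrite eq_ab //; lia.
Qed.

Lemma reverse_multiple_last : k * a 0 = a n.-1 %[mod g].
Proof.
have [n_gt0 _ _ def_N] := N_digits.
have N_mod : N = a 0 %[mod g] by rewrite def_N expansion_modn.
have kN_mod : k * N = a n.-1 %[mod g].
  rewrite reverse_multiple_expansion.
  by rewrite (expansion_modn g (fun i => a (n.-1 - i))) // subn0.
by rewrite -modnMmr -N_mod modnMmr.
Qed.

Lemma reverse_multiple_lead : k * a n.-1 <= a 0.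
Proof.
have [n_gt0 a_lt _ def_N] := N_digits.
have rev_lt i : i < n -> a (n.-1 - i) < g by move=> _; apply: a_lt; lia.
have gn_gt0 : 0 < g ^ n.-1 by rewrite expn_gt0 (leq_ltn_trans _ (a_lt 0 n_gt0)).
have N_lead : N %/ g ^ n.-1 = a n.-1 by rewrite def_N expansion_lead.
have kN_lead : (k * N) %/ g ^ n.-1 = a 0.
  by rewrite reverse_multiple_expansion (expansion_lead n_gt0 rev_lt) subnn.
by rewrite -N_lead -kN_lead leq_divRL // -mulnA leq_mul2l leq_divM orbT.
Qed.

End ReverseMultiple.

Section ExtremeDigits.

Variables g k b t : nat.
Hypotheses (b_lt : b < g) (kt_le : k * t <= b) (kb_mod : k * b = t %[mod g]).

Lemma predn_mul_add_leq : 0 < k -> k.-1 * (b + t) + (b - k * t) <= k.-1 * g.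
Proof.
move=> k_gt0; have t_lt : t < g.
  exact: leq_ltn_trans (leq_trans (leq_pmull t k_gt0) kt_le) b_lt.
have := divn_eq (k * b) g; rewrite kb_mod (modn_small t_lt).
have r_lt : (k * b) %/ g < k by rewrite ltn_divLR ?ltn_pmul2l //; lia.
move: (_ %/ _) r_lt => r r_lt def_kb.
have rg_le : r * g <= k.-1 * g by rewrite leq_mul2r; lia.
by case: k k_gt0 kt_le def_kb rg_le => // k'; lia.
Qed.

Lemma add_leq_base : 1 < k -> b + t <= g.
Proof.
move=> k_gt1; have k1_gt0 : 0 < k.-1 by lia.
by rewrite -(leq_pmul2l k1_gt0); have := predn_mul_add_leq (ltnW k_gt1); lia.
Qed.

Lemma dvdn_add_eq_base : 0 < k -> b + t = g -> k.+1 %| g.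
Proof.
move=> k_gt0 def_g; have := predn_mul_add_leq k_gt0; rewrite def_g => slack_le.
have def_b : b = k * t by lia.
by rewrite -def_g def_b addnC -mulSn dvdn_mulr.
Qed.

End ExtremeDigits.

Theorem theorem4 (g k N n : nat) (a : nat -> nat)
  (hg : 3 <= g) (hk : 2 <= k) (hkg : k < g)
  (hdig : base_digits g n a N) (hrev : reverse_multiple g k N) :
  a 0 + a n.-1 <= g /\ (a 0 + a n.-1 = g -> k.+1 %| g).
Proof.
have [n_gt0 a_lt _ _] := hdig.
have a0_lt := a_lt 0 n_gt0.
have lead_le := reverse_multiple_lead hdig hrev.
have last_mod := reverse_multiple_last hdig hrev.
split; first exact: add_leq_base lead_le last_mod hk.
exact: dvdn_add_eq_base lead_le last_mod (ltnW hk).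
Qed.
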